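(* Let $\chi$ be a subgroup property. Then the class of groups satisfying $\mathrm{RCC}$ on non-$\chi$ subgroups is a subclass of the class of groups satisfying $\mathrm{AC}_\chi$; that is, every group satisfying $\mathrm{RCC}$ on non-$\chi$ subgroups satisfies $\mathrm{AC}_\chi$.
   Context: A subgroup property $\chi$ is a property that a subgroup of a group may or may not have; subgroups of $G$ with the property are called $\chi$-subgroups of $G$, the others non-$\chi$ subgroups. A group $G$ satisfies $\mathrm{RCC}$ (real chain condition) on non-$\chi$ subgroups if the set of non-$\chi$ subgroups of $G$, ordered by inclusion, contains no subposet of the order type of $\mathbb R$. $G$ satisfies $\mathrm{AC}_\chi$ if there is no infinite antichain (with respect to inclusion) $(H_\lambda)_{\lambda\in\Lambda}$ of mutually permutable subgroups of $G$ (i.e. $H_\lambda H_\mu=H_\mu H_\lambda$ for all $\lambda,\mu$) such that (1) for every $\lambda\in\Lambda$, $H_\lambda\not\le \langle H_\gamma\mid\gamma\in\Lambda\setminus\{\lambda\}\rangle$; and (2) for every infinite $\Lambda_0\subseteq\Lambda$, the join $\langle H_\lambda\mid\lambda\in\Lambda_0\rangle$ is not a $\chi$-subgroup of $G$. *)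

(* Defs.v *)
From mathcomp Require Import all_boot all_order all_algebra.
From mathcomp Require Import boolp classical_sets functions cardinality reals.

Set Implicit Arguments.
Unset Strict Implicit.
Unset Printing Implicit Defensive.

Import Order.TTheory GRing.Theory Num.Theory.

Local Open Scope classical_set_scope.

Definition is_subgroup (G : groupType) (H : set G) : Prop :=
  group_closed (mem H).

(* A property of a subgroup H of a group G, depending on the pair (G, H) and
   not assumed invariant under isomorphism. Its values at sets that are not
   subgroups are never used. *)
Definition subgroup_property : Type := forall G : groupType, set G -> Prop.

Definition non_chi_subgroup (chi : subgroup_property) (G : groupType)
    (H : set G) : Prop :=
  is_subgroup H /\ ~ chi G H.

(* A subposet of the order type of the reals is the image of an order embedding
   of R; every realType is order-isomorphic to the reals. *)
Definition satisfies_RCC (R : realType) (chi : subgroup_property)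
    (G : groupType) : Prop :=
  ~ exists f : R -> set G,
      (forall x, non_chi_subgroup chi (f x)) /\
      (forall x y, f x `<=` f y <-> (x <= y)%R).

Definition setmulg (G : groupType) (H K : set G) : set G :=
  [set (x * y)%g | x in H & y in K].

Definition join_subgroups (G : groupType) (L : Type) (H : L -> set G)
    (L0 : set L) : set G :=
  smallest (@is_subgroup G) (\bigcup_(l in L0) H l).

Definition antichain (G : groupType) (L : Type) (H : L -> set G) : Prop :=
  forall l m, l <> m -> ~ H l `<=` H m.

Definition mutually_permutable (G : groupType) (L : Type) (H : L -> set G) :
    Prop :=
  forall l m, setmulg (H l) (H m) = setmulg (H m) (H l).

Definition satisfies_AC (chi : subgroup_property) (G : groupType) : Prop :=
  ~ exists (L : Type) (H : L -> set G),
      infinite_set [set: L] /\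
      (forall l, is_subgroup (H l)) /\
      antichain H /\
      mutually_permutable H /\
      (forall l, ~ H l `<=` join_subgroups H [set~ l]) /\
      (forall L0 : set L, infinite_set L0 -> ~ chi G (join_subgroups H L0)).

(* Main.v *)
Require Import Defs.
From mathcomp Require Import all_boot all_order all_algebra.
From mathcomp Require Import boolp classical_sets functions cardinality reals.

(** Suppose that a family [H] violates the antichain condition.  Its index set,
    being infinite, contains a copy [(e q)] of the rationals.  Send a real [x]
    to the join of the [H (e q)] with [q < x].  These joins grow with [x], and
    none is a chi-subgroup because each runs over infinitely many indices
    ([infinite_rational_cut]).  They are strictly increasing by independence:
    if [y < x], any rational [q] with [y < q < x] gives a subgroup [H (e q)]
    that lies in the join for [x] but not in the join for [y], since the indices
    of the latter all differ from [e q].  So the order type of the reals embeds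
    in the poset of non-chi subgroups, against the real chain condition. *)

Set Implicit Arguments.
Unset Strict Implicit.
Unset Printing Implicit Defensive.

Import Order.TTheory GRing.Theory Num.Theory.
Local Open Scope classical_set_scope.
Local Open Scope ring_scope.

Lemma is_subgroup_join (G : groupType) (L : Type) (H : L -> set G)
    (L0 : set L) :
  is_subgroup (join_subgroups H L0).
Proof.
split; first by rewrite inE => A [[A1 _] _]; rewrite inE in A1.
move=> x y; rewrite !inE => Hx Hy A [sgA HA].
have [_ Adiv] := sgA.
have xA : x \in mem A by rewrite inE; apply: Hx.
have yA : y \in mem A by rewrite inE; apply: Hy.
by have := Adiv x y xA yA; rewrite inE.
Qed.

Lemma join_subgroups_mono (G : groupType) (L : Type) (H : L -> set G)
    (L1 L2 : set L) :
  L1 `<=` L2 -> join_subgroups H L1 `<=` join_subgroups H L2.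
Proof.
move=> L12; apply: sub_smallest2r; first exact: is_subgroup_join.
exact: bigcup_subset.
Qed.

Lemma sub_join_subgroups (G : groupType) (L : Type) (H : L -> set G)
    (L0 : set L) (l : L) :
  L0 l -> H l `<=` join_subgroups H L0.
Proof. by move=> L0l; apply: sub_smallest; apply: bigcup_sup. Qed.

Lemma infinite_image_inj (T U : Type) (f : T -> U) (A : set T) :
  injective f -> infinite_set A -> infinite_set (f @` A).
Proof.
move=> f_inj infA finfA; apply: infA.
have f_injA : {in f @^-1` (f @` A) &, injective f} by move=> x y _ _ /f_inj.
exact: sub_finite_set (@preimage_image _ _ f A) (finite_preimage f_injA finfA).
Qed.

(** An infinite type contains a copy
    of [nat], and a countable type injects into [nat] by [pickle]. *)
Lemma countable_embeds_infinite (C : countType) (L : Type) :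
  infinite_set [set: L] -> exists e : C -> L, injective e.
Proof.
move=> /infiniteP/card_leP/unsquash f.
exists (fun c => \val (f (SigSub (mem_set (I : [set: nat] (pickle c)))))).
move=> c d /val_inj cd; apply: (pcan_inj pickleK).
by have /(congr1 \val) := inj (in_setT _) (in_setT _) cd.
Qed.

Definition rational_cut (R : realType) (x : R) : set rat :=
  [set q | ratr q < x].

(** Starting from one rational below [x], which density provides, repeatedly
    subtracting 1 yields infinitely many more. *)
Lemma infinite_rational_cut (R : realType) (x : R) :
  infinite_set (rational_cut x).
Proof.
have /rat_in_itvoo[q0] : x - 1 < x by rewrite ltrBlDr ltrDl.
rewrite in_itv /= => /andP[_ q0x].
pose below (n : nat) : rat := q0 - n%:R.
have below_inj : injective below.
  by move=> m n /addrI/oppr_inj/eqP; rewrite eqr_nat => /eqP.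
apply: sub_infinite_set (infinite_image_inj below_inj infinite_nat).
move=> _ [n _ <-]; apply: le_lt_trans q0x.
by rewrite ler_rat gerBl.
Qed.

Theorem lemma2p2 (R : realType) (chi : subgroup_property) (G : groupType) :
  satisfies_RCC R chi G -> satisfies_AC chi G.
Proof.
move=> RCC [L [H [infL [_ [_ [_ [indepH nchi]]]]]]]; apply: RCC.
have [e e_inj] := countable_embeds_infinite rat infL.
exists (fun x : R => join_subgroups H (e @` rational_cut x)); split.
  move=> x; split; first exact: is_subgroup_join.
  exact/nchi/infinite_image_inj/infinite_rational_cut.
move=> x y; split => [fxy | lexy]; last first.
  apply: join_subgroups_mono; apply: image_subset => q /= qx.
  exact: lt_le_trans lexy.
(* A rational strictly between y and x separates the two joins. *)
rewrite leNgt; apply/negP => /rat_in_itvoo[q]; rewrite in_itv /= => /andP[yq qx].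
have qjoin : H (e q) `<=` join_subgroups H (e @` rational_cut x).
  by apply: sub_join_subgroups; exists q.
apply: (indepH (e q)); apply: (subset_trans qjoin); apply: (subset_trans fxy).
apply: join_subgroups_mono => _ [r /= ry <-] /e_inj rq.
by move: ry; rewrite /rational_cut /= rq => /(lt_trans yq); rewrite ltxx.
Qed.
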